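(* Let $G$ be a countable group, $\mathcal{A}$ a finite alphabet, $X \subseteq \mathcal{A}^G$ a subshift, $\phi$ a cocycle on the Gibbs relation $\mathfrak{T}_X$, and $\mu$ a Borel probability measure on $X$ that is DLR with respect to $\phi$. Then $\mu$ is $(\phi, \mathfrak{T}_X)$-conformal.
   Context: $G$ is a countable group and $\mathcal{A}$ is a finite alphabet with the discrete topology. A subshift $X \subseteq \mathcal{A}^G$ is a closed subset (product topology) invariant under the shift action $(g\cdot x)_h = x_{g^{-1}h}$. $X$ carries its Borel $\sigma$-algebra $\mathcal{F}$; ''measure on $X$'' means Borel probability measure. $\Lambda \Subset G$ means $\Lambda$ is a finite subset of $G$. For $S\subseteq G$, $\mathcal{F}_S$ is the sub-$\sigma$-algebra of $\mathcal F$ generated by the coordinates $x_g$, $g\in S$. For $\eta\in\mathcal{A}^\Lambda$ and $x\in X$, $\eta x_{\Lambda^c}$ is the element of $\mathcal{A}^G$ equal to $\eta$ on $\Lambda$ and to $x$ on $\Lambda^c$. Gibbs relation: $\mathfrak{T}_X\subset X\times X$ is the set of pairs $(x,y)$ such that $x_{\Lambda^c}=y_{\Lambda^c}$ for some $\Lambda\Subset G$; it is an equivalence relation and a Borel set. For Borel $A\subseteq X$, $\mathfrak{T}_X(A)=\bigcup_{x\in A}\{y\in X: (x,y)\in\mathfrak{T}_X\}$. Cocycle: a Borel measurable function $\phi:\mathfrak{T}_X\to\mathbb{R}$ with $\phi(x,y)+\phi(y,z)=\phi(x,z)$ whenever $(x,y),(y,z)\in\mathfrak{T}_X$. Holonomy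 of $\mathfrak{T}_X$: a Borel isomorphism $\psi:A\to B$ between Borel sets $A,B\subseteq X$ with $(x,\psi(x))\in\mathfrak{T}_X$ for all $x\in A$. $\mu$ is $\mathfrak{T}_X$-nonsingular if $\mu(A)=0$ implies $\mu(\mathfrak{T}_X(A))=0$ for every Borel $A\subseteq X$. $\mu$ is $(\phi,\mathfrak{T}_X)$-conformal if it is $\mathfrak{T}_X$-nonsingular and for every holonomy $\psi:A\to B$ of $\mathfrak{T}_X$, $\mu(B)=\int_A \exp(\phi(x,\psi(x)))\,d\mu(x)$. DLR: $\mu$ is DLR with respect to $\phi$ if for every Borel $A\subseteq X$ and every $\Lambda\Subset G$, for $\mu$-a.e. $x\in X$, $$\mu(A\,|\,\mathcal{F}_{\Lambda^c})(x)=\sum_{\eta\in\mathcal{A}^\Lambda}\left[\sum_{\zeta\in\mathcal{A}^\Lambda}\exp(\phi(\eta x_{\Lambda^c},\zeta x_{\Lambda^c}))\,\mathbf{1}_X(\zeta x_{\Lambda^c})\right]^{-1}\mathbf{1}_A(\eta x_{\Lambda^c}),$$ where terms containing a vanishing indicator ($\eta x_{\Lambda^c}\notin A$ in the outer sum, $\zeta x_{\Lambda^c}\notin X$ in the inner sum) are taken to be $0$, and $\mu(A\,|\,\mathcal{F}_{\Lambda^c})$ is the conditional probability of $A$ given $\mathcal{F}_{\Lambda^c}$. *)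

(* Defs.v *)
From HB Require Import structures.
From mathcomp Require Import all_boot all_order all_algebra finmap.
From mathcomp Require Import all_classical all_reals all_analysis.

Set Implicit Arguments.
Unset Strict Implicit.
Unset Printing Implicit Defensive.

Import Order.TTheory GRing.Theory Num.Theory.
Import numFieldNormedType.Exports.

Local Open Scope classical_set_scope.
Local Open Scope ring_scope.

Notation config G A := {ptws G -> discrete_topology A}.

Definition shift (G : groupType) (A : finType) (g : G) (x : config G A) :
  config G A := fun h => x (g^-1 * h)%g.

(* The field [subshift_nonempty] is there because measurable types are pointed
   in the library; it loses nothing, as an empty space carries no probability
   measure. *)
Record subshift (G : groupType) (A : finType) := Subshift {
  subshift_set :> set (config G A) ;
  subshift_closed : closed subshift_set ;
  subshift_invariant :
    forall g x, subshift_set x -> subshift_set (shift g x) ;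
  subshift_nonempty : subshift_set !=set0 }.

Section points.
Context (G : groupType) (A : finType).
Implicit Type X : subshift G A.

Definition points X : Type := set_type X.

Definition to_config X (x : points X) : config G A := val x.

HB.instance Definition _ X := Topological.copy (points X) (set_type X).

Fact points_inhabited X : exists x : points X, True.
Proof. by have [x Xx] := subshift_nonempty X; exists (exist _ x (mem_set Xx)). Qed.

HB.instance Definition _ X :=
  isPointed.Build (points X) (projT1 (cid (points_inhabited X))).

HB.instance Definition _ X := @isMeasurable.Build
  (sigma_display (@open (points X))) (points X) <<s @open (points X) >>
  (@sigma_algebra0 _ setT _) (@sigma_algebraC _ _) (@sigma_algebra_bigcup _ setT _).

Definition coord_sigma_algebra (X : subshift G A) (S : set G) : set (set (points X)) :=
  <<s \bigcup_(g in S)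
        preimage_set_system setT (fun x : points X => to_config x g) setT >>.

Definition patch_config (L : {fset G}) (eta : {ffun L -> A}) (x : config G A) :
  config G A := fun g => oapp eta (x g) (insub g).

(* [None] when the patched configuration leaves X *)
Definition resample X (L : {fset G}) (eta : {ffun L -> A}) (x : points X) :
  option (points X) :=
  (insub (patch_config eta (to_config x)) : option (set_type X)).

Definition gibbs_rel X : set (points X * points X) :=
  [set p | exists L : {fset G},
     forall g, g \notin L -> to_config p.1 g = to_config p.2 g].

Definition gibbs_saturation X (B : set (points X)) : set (points X) :=
  \bigcup_(x in B) [set y | gibbs_rel (x, y)].

End points.

Section measures.
Context (G : groupType) (A : finType) (X : subshift G A) (R : realType).
Implicit Types (phi : points X * points X -> R) (mu : probability (points X) R).

(* Functions on the Gibbs relation are represented by functions on X * X of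
   which only the restriction to [gibbs_rel] is used; X * X carries the product
   of the Borel sigma-algebras, which is its Borel sigma-algebra since X is
   second countable when G is countable. *)
Definition cocycle phi : Prop :=
  measurable_fun (@gibbs_rel G A X) phi /\
  forall x y z, gibbs_rel (x, y) -> gibbs_rel (y, z) ->
    phi (x, y) + phi (y, z) = phi (x, z).

(* Only the restriction of [psi] to [B] matters. *)
Definition borel_isomorphism (B C : set (points X))
    (psi : points X -> points X) : Prop :=
  [/\ measurable B, measurable C, set_bij B C psi, measurable_fun B psi &
      exists2 chi : points X -> points X,
        measurable_fun C chi & forall x, B x -> chi (psi x) = x].

Definition holonomy (B C : set (points X)) (psi : points X -> points X) : Prop :=
  borel_isomorphism B C psi /\ forall x, B x -> gibbs_rel (x, psi x).

Definition gibbs_nonsingular mu : Prop :=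
  forall B, measurable B -> mu B = 0%E -> mu (gibbs_saturation B) = 0%E.

Definition conformal phi mu : Prop :=
  gibbs_nonsingular mu /\
  forall B C psi, holonomy B C psi ->
    mu C = (\int[mu]_(x in B) (expR (phi (x, psi x)))%:E)%E.

(* [f] is a version of the conditional probability mu(B | F) *)
Definition cond_probability mu (F : set (set (points X))) (B : set (points X))
    (f : points X -> R) : Prop :=
  [/\ forall U, measurable U -> F (f @^-1` U),
      mu.-integrable setT (EFin \o f) &
      forall E, F E -> (\int[mu]_(x in E) (f x)%:E)%E = mu (B `&` E)].

(* [oapp _ 0] gives the value 0 to the terms whose configuration is not in X *)
Definition dlr_kernel phi (L : {fset G}) (B : set (points X)) (x : points X) : R :=
  \sum_(eta : {ffun L -> A})
    oapp (fun y =>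
      (\sum_(zeta : {ffun L -> A})
         oapp (fun z => expR (phi (y, z))) 0 (resample zeta x))^-1 * \1_B y)
      0 (resample eta x).

(* The conditional probability is determined only up to null sets: the DLR
   equation says that some version of it satisfies the formula almost
   everywhere, equivalently all of them do. *)
Definition DLR phi mu : Prop :=
  forall (B : set (points X)) (L : {fset G}), measurable B ->
    exists2 f : points X -> R,
      cond_probability mu (coord_sigma_algebra [set g | g \notin L]) B f &
      {ae mu, forall x, f x = dlr_kernel phi L B x}.

End measures.

(* Main.v *)
Require Import Defs.
From mathcomp Require Import all_boot all_order all_algebra finmap.
From mathcomp Require Import all_classical all_reals all_analysis.
From mathcomp Require Import measurable_realfun.

(** Write y ~_L x when x and y agree off the finite set L; each class of ~_L is
finite, and the Gibbs relation is the union of the relations ~_L. The DLR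
kernel at x is a probability vector on the class of x: it gives y the weight
w_L(y) = 1 / Z_L(y), where Z_L(y) is the sum of exp (phi (y, z)) over z ~_L y.
Integrating the DLR equation over the whole space removes the conditioning and
leaves
  mu B = \int (\sum_(y ~_L x) w_L(y) 1_B(y)) dmu(x)  for all Borel B,
and monotone convergence replaces 1_B by any measurable f >= 0 ([DLR_average]).
Both parts of conformality come from this one identity.

Nonsingularity ([DLR_nonsingular]): if mu B = 0, the inner sum vanishes almost
everywhere; as all the weights are positive, it vanishes at x exactly when no
point of B is ~_L x. So the ~_L-saturation of B is null, and the saturation of
B under the Gibbs relation is a countable union of such sets.

Change of variables: the cocycle equation says that Z_L(y) = exp (phi (y, z))
Z_L(z) if y ~_L z, that is, w_L(y) exp (phi (y, z)) = w_L(z)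
([weight_cocycle]). If a holonomy psi from B to C satisfies psi y ~_L y on B,
then it permutes points inside the ~_L-classes, so that summing this relation
with z = psi y over the points y of B in a class gives the sum of w_L over the
points of C in that class ([class_sum_bij]); integrating gives the conformal
formula ([DLR_conformal_agree]). A general holonomy is a countable disjoint
union of holonomies of this kind, since G has countably many finite subsets. *)

Set Implicit Arguments.
Unset Strict Implicit.
Unset Printing Implicit Defensive.

Import Order.TTheory GRing.Theory Num.Theory.
Import numFieldNormedType.Exports.
Import HBNNSimple.

Local Open Scope classical_set_scope.
Local Open Scope ring_scope.

(** * Continuity and measurability of coordinates and patching *)

Section topology.
Context (G : groupType) (A : finType).

Lemma continuous_to_config (X : subshift G A) :
  continuous (@to_config G A X).
Proof. exact: (@initial_continuous (set_type X) _ set_val). Qed.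

(** The product topology is the supremum of the topologies induced by the
coordinates. *)
Lemma continuous_config (T : topologicalType) (f : T -> config G A) :
  (forall g, continuous (fun t => f t g : discrete_topology A)) -> continuous f.
Proof.
move=> fc x; apply/cvg_sup => g; move: x.
apply/(@continuousP _ (initial_topology (@^~ g))) => B [C oC <-].
by move: C oC; apply/continuousP/fc.
Qed.

Lemma continuous_coord (g : G) :
  continuous (fun x : config G A => x g : discrete_topology A).
Proof.
by move=> x; apply: (@proj_continuous G (fun=> discrete_topology A) g).
Qed.

Lemma continuous_patch_config (L : {fset G}) (eta : {ffun L -> A}) :
  continuous (patch_config eta : config G A -> config G A).
Proof.
apply: continuous_config => g; rewrite /patch_config.
case: insubP => [l _ _|_] /=; first by move=> x; apply: cst_continuous.
exact: continuous_coord.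
Qed.

Lemma measurable_open_points (X : subshift G A) (U : set (points X)) :
  open U -> measurable U.
Proof. exact: sub_sigma_algebra. Qed.

Lemma measurable_preimage_config (X : subshift G A)
    (f : config G A -> config G A) (U : set (config G A)) :
  continuous f -> open U -> measurable [set x : points X | U (f (to_config x))].
Proof.
move=> fc oU; apply: measurable_open_points.
have /continuousP : continuous (f \o @to_config G A X).
  by move=> x; apply: continuous_comp; [exact: continuous_to_config|exact: fc].
exact.
Qed.

Lemma measurable_cylinder (X : subshift G A) (g : G) (a : A) :
  measurable [set x : points X | to_config x g = a].
Proof.
apply: measurable_open_points.
have c : continuous (fun x : points X => to_config x g : discrete_topology A).
  move=> x; apply: (@continuous_comp _ _ _ (@to_config G A X)
    (fun x : config G A => x g : discrete_topology A)).
    exact: continuous_to_config.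
  exact: continuous_coord.
move/continuousP: c => /(_ [set a]); apply.
exact: discrete_open.
Qed.

End topology.

(** * The Gibbs relation as a countable union *)

Lemma countable_enumeration (T : choiceType) (t0 : T) :
  countable [set: T] -> exists s : nat -> T, forall t, exists n, s n = t.
Proof.
move=> /countable_injP[f finj].
exists (fun n => xget t0 [set t | f t = n]) => t; exists (f t).
have /= ft : [set u | f u = f t] (xget t0 [set u | f u = f t]).
  exact: (@xgetPex _ t0 _ (ex_intro _ t _)).
by apply: finj; rewrite ?inE.
Qed.

(** A finite set is recovered from the list of the codes of its elements, and
lists of natural numbers are countable. *)
Lemma countable_fsets (T : choiceType) :
  countable [set: T] -> countable [set: {fset T}].
Proof.
move=> /countable_injP[f finj]; apply/countable_injP.
exists (fun K : {fset T} => choice.pickle [seq f t | t <- K]) => K K' _ _.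
move=> /(pcan_inj (@choice.pickleK _)) /inj_map e; apply/fsetP => t.
by rewrite -[LHS]/(t \in enum_fset K) e// => x y; apply: finj; rewrite inE.
Qed.

Section points.
Context (G : groupType) (A : finType) (X : subshift G A).
Implicit Types (L : {fset G}) (x y z : points X).

Definition agree_off L : set (points X * points X) :=
  [set p | forall g, g \notin L -> to_config p.1 g = to_config p.2 g].

(** The total version of [resample]: where the patched configuration leaves X,
the point is kept. Both values agree with x off L, so that [(x, recolor eta x)]
always lies in the Gibbs relation, the set on which a cocycle is measurable. *)
Definition recolor L (eta : {ffun L -> A}) x : points X :=
  odflt x (resample eta x).

Definition restrict_config L x : {ffun L -> A} :=
  [ffun l => to_config x (val l)].

Lemma patch_config_in L (eta : {ffun L -> A}) c g (gL : g \in L) :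
  patch_config eta c g = eta [` gL]%fset.
Proof. by rewrite /patch_config insubT. Qed.

Lemma patch_config_notin L (eta : {ffun L -> A}) c g :
  g \notin L -> patch_config eta c g = c g.
Proof. by move=> gL; rewrite /patch_config insubN. Qed.

(** So the points of X that agree with x off L are listed once each by the
patterns on L whose patch of x stays in X. *)
Lemma resample_SomeP L (eta : {ffun L -> A}) x y :
  resample eta x = Some y <->
  agree_off L (x, y) /\ restrict_config L y = eta.
Proof.
rewrite /resample; split.
  case: insubP => [y' _ ey'|//] [] <-; split.
    by move=> g gL /=; rewrite -[to_config y']/(val y') ey' patch_config_notin.
  apply/ffunP => -[g gL]; rewrite ffunE -[to_config y']/(val y') ey' /=.
  by rewrite patch_config_in.
move=> [xy ey].
have e : patch_config eta (to_config x) = to_config y.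
  apply/funext => g; have [gL|gL] := boolP (g \in L).
    by rewrite patch_config_in -ey ffunE.
  by rewrite patch_config_notin// xy.
rewrite e.
have -> : insub (to_config y) = insub (val y) :> option (set_type X) by [].
by rewrite valK.
Qed.

Lemma agree_offC L x y : agree_off L (x, y) -> agree_off L (y, x).
Proof. by move=> xy g gL /=; rewrite [RHS]xy. Qed.

Lemma agree_off_trans L x y z :
  agree_off L (x, y) -> agree_off L (y, z) -> agree_off L (x, z).
Proof. by move=> xy yz g gL /=; rewrite [LHS]xy//; exact: yz. Qed.

Lemma agree_off_recolor L (eta : {ffun L -> A}) x :
  agree_off L (x, recolor eta x).
Proof.
rewrite /recolor; case E : (resample eta x) => [y|] //=.
by have /resample_SomeP[] := E.
Qed.

Lemma agree_off_gibbs L x y : agree_off L (x, y) -> gibbs_rel (x, y).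
Proof. by exists L. Qed.

(** X is closed and patching is continuous, so this set is closed. *)
Lemma measurable_admissible L (eta : {ffun L -> A}) :
  measurable [set x : points X | resample eta x].
Proof.
have -> : [set x : points X | resample eta x] =
    [set x | subshift_set X (patch_config eta (to_config x))].
  apply/seteqP; split=> x /=; rewrite /resample.
    by case: insubP => // u; rewrite inE.
  by case: insubP => // /negP h Xx; exfalso; apply: h; rewrite inE.
rewrite -[X in measurable X]setCK; apply: measurableC.
apply: (@measurable_preimage_config G A X _ (~` subshift_set X)).
  exact: continuous_patch_config.
by apply: closed_openC; exact: subshift_closed.
Qed.

(** It is a continuous patch on a closed set, and the identity off that set. *)
Lemma measurable_recolor L (eta : {ffun L -> A}) :
  measurable_fun [set: points X] (@recolor L eta).
Proof.
apply: (@measurability _ _ (points X) (points X) setT (@recolor L eta)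
  (@open (points X))) => //.
move=> _ [U oU <-].
have [V oV eU] : exists2 V, open V & @to_config G A X @^-1` V = U by exact: oU.
pose D := [set x : points X | resample eta x].
have mD : measurable D by exact: measurable_admissible.
have -> : setT `&` recolor eta @^-1` U =
    (D `&` [set x | V (patch_config eta (to_config x))]) `|` (U `\` D).
  apply/seteqP; split=> [x [_]|x] /=; rewrite /D /recolor /=.
    case E : (resample eta x) => [y|] /=; last by right.
    rewrite -eU /= => Vy; left; split=> //; move: E; rewrite /resample.
    by case: insubP => //= u _ <- [->].
  case E : (resample eta x) => [y|] /=; last by case=> -[].
  move=> [[_]|[_] //]; rewrite -eU /=; move: E; rewrite /resample.
  by case: insubP => //= u _ <- [->].
apply: measurableU; last first.
  by apply: measurableD => //; exact: measurable_open_points.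
apply: measurableI => //; apply: measurable_preimage_config => //.
exact: continuous_patch_config.
Qed.

Hypothesis G_countable : countable [set: G].

(** Agreement off L is a countable intersection, over the sites outside L, of
finite unions of products of cylinders. *)
Lemma measurable_agree_off L : measurable (agree_off L).
Proof.
have [e esurj] := countable_enumeration (1%g : G) G_countable.
have -> : agree_off L = \bigcap_n
   [set p | e n \notin L -> to_config p.1 (e n) = to_config p.2 (e n)].
  apply/seteqP; split=> [p pL n _|p pL g] /=; first exact: pL.
  by have [n <-] := esurj g; exact: pL.
apply: bigcapT_measurable => n; set g := e n.
have [gL|gL] := boolP (g \in L).
  rewrite (_ : [set _ | _] = setT); first exact: measurableT.
  by apply/seteqP; split.
have -> : [set p | true -> to_config p.1 g = to_config p.2 g] =
    \bigcup_(a in [set: A]) ([set x : points X | to_config x g = a] `*`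
                             [set x : points X | to_config x g = a]).
  apply/seteqP; split=> [[x y] /= xy|[x y] [a _ [/= -> ->]]] //.
  by exists (to_config x g) => //; split=> //=; rewrite xy.
apply: fin_bigcup_measurable => // a _.
by apply: measurableX; exact: measurable_cylinder.
Qed.

Lemma gibbs_rel_exhaustion : exists L : nat -> {fset G},
  @gibbs_rel G A X = \bigcup_n agree_off (L n).
Proof.
have [L Lsurj] := countable_enumeration fset0 (countable_fsets G_countable).
exists L; apply/seteqP; split=> [p [K pK]|p [n _ pn]]; last by exists (L n).
by have [n LK] := Lsurj K; exists n => //; rewrite LK.
Qed.

Lemma measurable_gibbs_rel : measurable (@gibbs_rel G A X).
Proof.
have [L ->] := gibbs_rel_exhaustion.
by apply: bigcup_measurable => n _; exact: measurable_agree_off.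
Qed.

End points.

(** * Sums over the finite classes of agreement off L *)

Section class_sum.
Context (G : groupType) (A : finType) (X : subshift G A) (R : realType).
Implicit Types (L : {fset G}) (x y z : points X) (f : points X -> R).

Definition agreement_class L x : set (points X) := [set y | agree_off L (x, y)].

Definition class_sum L f x : R :=
  \sum_(eta : {ffun L -> A}) oapp f 0 (resample eta x).

(** Indexing by the points of the class, rather than by patterns on L, makes
the sum visibly depend on the class only and lets a holonomy reindex it. *)
Lemma class_sumE L f x : class_sum L f x = \sum_(y \in agreement_class L x) f y.
Proof.
pose P := [set eta : {ffun L -> A} | resample eta x].
transitivity (\sum_(eta \in P) oapp f 0 (resample eta x)).
  rewrite (@fsbig_fwiden _ _ _ _ (index_enum {ffun L -> A}))//.
  - by move=> eta _ /=; rewrite mem_index_enum.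
  - exact: index_enum_uniq.
  - by move=> eta [_] /=; rewrite /P /=; case: (resample eta x) => //= y [].
rewrite (@reindex_fsbig _ _ _ _ _ (@restrict_config G A X L)
  (agreement_class L x)).
  apply: eq_fsbigr => y /set_mem xy.
  by rewrite (proj2 (resample_SomeP (restrict_config L y) x y)).
split.
- move=> y xy; rewrite /P /=.
  by rewrite (proj2 (resample_SomeP (restrict_config L y) x y)).
- move=> y z /set_mem xy /set_mem xz yz.
  have := proj2 (resample_SomeP (restrict_config L y) x y) (conj xy erefl).
  rewrite (proj2 (resample_SomeP (restrict_config L y) x z)); first by case.
  by split=> //; exact: esym yz.
- move=> eta; rewrite /P /=; case E : (resample eta x) => [y|] // _.
  by have /resample_SomeP[xy <-] := E; exists y.
Qed.

Lemma agreement_class_eq L x y : agree_off L (x, y) ->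
  agreement_class L y = agreement_class L x.
Proof.
move=> xy; apply/seteqP; split=> z; apply: agree_off_trans => //.
exact: agree_offC.
Qed.

Lemma class_sum_agree L f x y :
  agree_off L (x, y) -> class_sum L f y = class_sum L f x.
Proof. by move=> xy; rewrite !class_sumE (agreement_class_eq xy). Qed.

(** This form, a sum over a fixed finite set of products of total functions,
serves measurability proofs. *)
Lemma class_sum_recolor L f x : class_sum L f x =
  \sum_(eta : {ffun L -> A})
    \1_[set u : points X | resample eta u] x * f (recolor eta x).
Proof.
apply: eq_bigr => eta _; rewrite indicE /recolor.
case E : (resample eta x) => [y|] /=.
  by rewrite mem_set ?mul1r//= E.
by rewrite memNset ?mul0r//= E.
Qed.

Lemma eq_class_sum L f f' x :
  (forall y, agree_off L (x, y) -> f y = f' y) ->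
  class_sum L f x = class_sum L f' x.
Proof.
by move=> ff'; rewrite !class_sumE; apply: eq_fsbigr => y /set_mem/ff'.
Qed.

Lemma class_sum_ge0 L f x : (forall y, 0 <= f y) -> 0 <= class_sum L f x.
Proof.
by move=> f0; apply: sumr_ge0 => eta _; case: (resample eta x) => /=.
Qed.

Lemma le_class_sum L f f' x :
  (forall y, f y <= f' y) -> class_sum L f x <= class_sum L f' x.
Proof.
by move=> ff'; apply: ler_sum => eta _; case: (resample eta x) => /=.
Qed.

Lemma class_sum_ge L f x y : (forall z, 0 <= f z) -> agree_off L (x, y) ->
  f y <= class_sum L f x.
Proof.
move=> f0 xy; rewrite /class_sum (bigD1 (restrict_config L y))//=.
rewrite (proj2 (resample_SomeP _ x y) (conj xy erefl)) /= lerDl.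
by apply: sumr_ge0 => eta _; case: (resample eta x) => /=.
Qed.

Lemma class_sum_sum (I : Type) (s : seq I) L (F : I -> points X -> R) x :
  class_sum L (fun y => \sum_(i <- s) F i y) x =
  \sum_(i <- s) class_sum L (F i) x.
Proof.
rewrite /class_sum exchange_big /=; apply: eq_bigr => eta _.
by case: (resample eta x) => [y|] //=; rewrite big1.
Qed.

Lemma class_sumZ L a f x :
  class_sum L (fun y => a * f y) x = a * class_sum L f x.
Proof.
rewrite /class_sum mulr_sumr; apply: eq_bigr => eta _.
by case: (resample eta x) => //=; rewrite mulr0.
Qed.

Lemma cvg_class_sum L (F : nat -> points X -> R) f x :
  (forall y, F n y @[n --> \oo] --> f y) ->
  class_sum L (F n) x @[n --> \oo] --> class_sum L f x.
Proof.
move=> Ff; apply: cvg_big => [|eta _]; first exact: add_continuous.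
by case: (resample eta x) => [y|] /=; [exact: Ff|exact: cvg_cst].
Qed.

Lemma measurable_class_sum L f :
  measurable_fun setT f -> measurable_fun setT (class_sum L f).
Proof.
move=> mf; apply: (eq_measurable_fun (fun x => \sum_(eta : {ffun L -> A})
  \1_[set u : points X | resample eta u] x * f (recolor eta x))).
  by move=> x _; rewrite class_sum_recolor.
apply: measurable_sum => eta; apply: measurable_funM.
  by apply: measurable_indic; exact: measurable_admissible.
by apply: measurableT_comp => //; exact: measurable_recolor.
Qed.

(** [psi] moves points inside the classes of agreement off L, so it restricts
to a bijection between the points of B and those of C in each class. *)
Lemma class_sum_bij L (B C : set (points X)) psi f x :
  set_bij B C psi -> (forall y, B y -> agree_off L (y, psi y)) ->
  class_sum L (fun y => \1_B y * f (psi y)) x =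
  class_sum L (fun y => \1_C y * f y) x.
Proof.
move=> [psiBC psiinj psisurj] Bpsi; rewrite !class_sumE.
have h (D : set (points X)) (g : points X -> R) :
    \sum_(y \in agreement_class L x) \1_D y * g y =
    \sum_(y \in agreement_class L x `&` D) g y.
  rewrite fsbig_mkcondr; apply: eq_fsbigr => y _.
  by rewrite indicE; case: ifP => _; rewrite ?mul1r ?mul0r.
rewrite !h; apply/esym/reindex_fsbig; split.
- move=> y [xy By]; split; last exact: psiBC.
  by apply: agree_off_trans xy _; exact: Bpsi.
- by move=> y z /set_mem[_ By] /set_mem[_ Bz]; apply: psiinj; exact: mem_set.
- move=> z [xz /psisurj[y By yz]]; exists y => //; split=> //.
  by apply: agree_off_trans xz _; rewrite -yz; apply: agree_offC; exact: Bpsi.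
Qed.

End class_sum.

(** * The DLR equation integrated against functions *)

Section weight.
Context (G : groupType) (A : finType) (X : subshift G A) (R : realType).
Context (phi : points X * points X -> R).
Implicit Types (L : {fset G}) (x y z : points X) (f : points X -> R).
Implicit Types (B C : set (points X)).

(** The DLR kernel at x normalizes over the class of x; for y in that class the
sum may be taken at y, which leaves a weight that does not depend on x. *)
Definition weight L y : R := (class_sum L (fun z => expR (phi (y, z))) y)^-1.

Lemma weight_gt0 L y : 0 < weight L y.
Proof.
rewrite invr_gt0; apply: lt_le_trans (expR_gt0 (phi (y, y))) _.
by apply: (@class_sum_ge _ _ _ _ L (fun z => expR (phi (y, z)))).
Qed.

Lemma dlr_kernelE L B x :
  dlr_kernel phi L B x = class_sum L (fun y => weight L y * \1_B y) x.
Proof.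
rewrite -[LHS]/(class_sum L (fun y =>
  (class_sum L (fun z => expR (phi (y, z))) x)^-1 * \1_B y) x).
by apply: eq_class_sum => y xy; rewrite /weight (class_sum_agree _ xy).
Qed.

Hypothesis phi_cocycle : cocycle phi.

(** The cocycle equation pulls the factor [expR (phi (y, z))] out of the
normalizing sum at y and leaves the normalizing sum at z. *)
Lemma weight_cocycle L y z : agree_off L (y, z) ->
  weight L y * expR (phi (y, z)) = weight L z.
Proof.
move=> yz; rewrite /weight.
rewrite (@eq_class_sum _ _ _ _ _ _
  (fun u => expR (phi (y, z)) * expR (phi (z, u)))).
  rewrite class_sumZ (class_sum_agree _ yz) invfM mulrAC mulVf ?mul1r//.
  by rewrite gt_eqF ?expR_gt0.
move=> u yu; rewrite -expRD phi_cocycle.2//; first exact: agree_off_gibbs yz.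
apply: (@agree_off_gibbs _ _ _ L); apply: agree_off_trans yu; exact: agree_offC.
Qed.

Hypothesis G_countable : countable [set: G].

(** A cocycle is measurable on the Gibbs relation only, hence the condition
that the graph of [f] lies in it. *)
Lemma measurable_cocycle_graph (f : points X -> points X) :
  measurable_fun setT f -> (forall x, gibbs_rel (x, f x)) ->
  measurable_fun setT (fun x => phi (x, f x)).
Proof.
move=> mf fgibbs.
apply: (@measurable_comp _ _ _ _ _ _ (@gibbs_rel G A X) phi setT
  (fun x => (x, f x))).
- exact: measurable_gibbs_rel.
- by move=> _ [x _ <-].
- exact: phi_cocycle.1.
- by apply: measurable_fun_pair => //; exact: measurable_id.
Qed.

Lemma measurable_weight L : measurable_fun setT (weight L).
Proof.
pose Z y := class_sum L (fun z => expR (phi (y, z))) y.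
(* Z is positive, so its inverse is its real power of exponent -1, and real
   powers are measurable. *)
apply: (eq_measurable_fun (fun y => (Z y) `^ (-1))).
  by move=> y _; rewrite powR_inv1// -invr_ge0; exact/ltW/weight_gt0.
apply: (@measurableT_comp _ _ _ _ _ _ (fun t : R => t `^ (-1)) _ Z).
  exact: measurable_powR.
apply: (eq_measurable_fun (fun y => \sum_(eta : {ffun L -> A})
  \1_[set u : points X | resample eta u] y * expR (phi (y, recolor eta y)))).
  by move=> y _; rewrite /Z class_sum_recolor.
apply: measurable_sum => eta; apply: measurable_funM.
  by apply: measurable_indic; exact: measurable_admissible.
apply: measurableT_comp; first exact: measurable_expR.
apply: measurable_cocycle_graph; first exact: measurable_recolor.
move=> x; apply: agree_off_gibbs; exact: agree_off_recolor.
Qed.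

(** The integral of f against the DLR kernel at x. *)
Definition average L f x := class_sum L (fun y => weight L y * f y) x.

Lemma measurable_average L f :
  measurable_fun setT f -> measurable_fun setT (average L f).
Proof.
move=> mf; apply: measurable_class_sum; apply: measurable_funM => //.
exact: measurable_weight.
Qed.

Lemma average_ge0 L f x : (forall y, 0 <= f y) -> 0 <= average L f x.
Proof.
by move=> f0; apply: class_sum_ge0 => y; rewrite mulr_ge0// ltW// weight_gt0.
Qed.

Context (mu : probability (points X) R) (mu_DLR : DLR phi mu).

(** The integral of a conditional probability over the whole space is the
unconditional probability. *)
Lemma DLR_average_indic L B : measurable B ->
  mu B = (\int[mu]_x (average L \1_B x)%:E)%E.
Proof.
move=> mB; have [f [mf fint fE] fkernel] := mu_DLR L mB.
have := fE setT; rewrite setIT => <-; last first.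
  by have := mf _ measurableT; rewrite preimage_setT.
apply: ae_eq_integral => //.
- exact: measurable_int fint.
- by apply/measurable_EFinP; apply: measurable_average; exact: measurable_indic.
by apply: filterS fkernel => x fx _; rewrite fx dlr_kernelE.
Qed.

Lemma average_nnsfun L (h : {nnsfun points X >-> R}) x :
  average L h x = \sum_(a \in range h) a * average L \1_(h @^-1` [set a]) x.
Proof.
rewrite fsbig_finite//=.
under eq_bigr do rewrite -class_sumZ.
rewrite -class_sum_sum; apply: eq_class_sum => y _.
rewrite {1}(fimfunE h y) fsbig_finite//=.
by rewrite mulr_sumr; apply: eq_bigr => a _; rewrite mulrCA.
Qed.

Lemma DLR_average_nnsfun L (h : {nnsfun points X >-> R}) :
  (\int[mu]_x (h x)%:E = \int[mu]_x (average L h x)%:E)%E.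
Proof.
rewrite integralT_nnsfun sintegralE.
have mh a : measurable (h @^-1` [set a]) by exact: measurable_sfunP.
pose F a x := (a * average L \1_(h @^-1` [set a]) x)%:E.
(* The sum lemmas for integrals ask for nonnegative terms at every index a: for
   a < 0 the fibre of h is empty and the term is 0. *)
have F0 a x : (0 <= F a x)%E.
  rewrite lee_fin; have [a0|a0] := leP 0 a.
    by rewrite mulr_ge0// average_ge0// => y; rewrite indicE.
  have -> : h @^-1` [set a] = set0.
    apply/seteqP; split=> // y /= hy; have : 0 <= h y by [].
    by rewrite hy leNgt a0.
  rewrite /average (@eq_class_sum _ _ _ _ _ _ (fun=> 0)).
    by rewrite class_sumE fsbig1 ?mulr0.
  by move=> y _; rewrite indic0 mulr0.
have mF a : measurable_fun setT (F a).
  apply/measurable_EFinP/measurable_funM => //.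
  by apply: measurable_average; exact: measurable_indic.
transitivity (\int[mu]_x (\sum_(a \in range h) F a x)%E)%E; last first.
  apply: eq_integral => x _; rewrite average_nnsfun.
  by rewrite !fsbig_finite//= sumEFin.
rewrite ge0_integral_fsum//.
apply: eq_fsbigr => a /set_mem[x _ <-].
transitivity ((h x)%:E * \int[mu]_y (average L \1_(h @^-1` [set h x]) y)%:E)%E.
  by congr (_ * _)%E; exact: DLR_average_indic.
rewrite -ge0_integralZl_EFin//.
- by move=> y _; rewrite lee_fin average_ge0// => z; rewrite indicE.
- by apply/measurable_EFinP; apply: measurable_average; exact: measurable_indic.
Qed.

(** Both sides are continuous along the nondecreasing approximation of f by
simple functions: the average of f at x is a finite sum with nonnegative
weights, so it inherits monotonicity and convergence. *)
Lemma DLR_average L f : measurable_fun setT f -> (forall x, 0 <= f x) ->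
  (\int[mu]_x (f x)%:E = \int[mu]_x (average L f x)%:E)%E.
Proof.
move=> mf f0.
have mEf : measurable_fun setT (EFin \o f) by exact/measurable_EFinP.
pose h := nnsfun_approx measurableT mEf.
have hf x : h n x @[n --> \oo] --> f x.
  apply: (fine_cvg (cvg_nnsfun_approx measurableT mEf _ _)) => //.
  by move=> y _; rewrite lee_fin.
have hndecr x : {homo (fun n => h n x) : n m / (n <= m)%N >-> n <= m}.
  by move=> n m nm; have /lefP := nd_nnsfun_approx measurableT mEf nm; exact.
have cvg_int (F : nat -> points X -> R) (F' : points X -> R) :
    (forall n, measurable_fun setT (F n)) -> (forall n x, 0 <= F n x) ->
    (forall x, {homo F ^~ x : n m / (n <= m)%N >-> n <= m}) ->
    (forall x, F n x @[n --> \oo] --> F' x) ->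
    (\int[mu]_x (F n x)%:E @[n --> \oo] --> \int[mu]_x (F' x)%:E)%E.
  move=> mF F0 ndF FF'.
  have -> : (\int[mu]_x (F' x)%:E = \int[mu]_x limn (fun n => (F n x)%:E))%E.
    apply: eq_integral => x _; apply/esym/cvg_lim => //.
    by apply: cvg_EFin; [exact: nearW|exact: FF'].
  apply: cvg_monotone_convergence => //.
  - by move=> n; exact/measurable_EFinP.
  - by move=> n x _; rewrite lee_fin.
  - by move=> x _ n m nm; rewrite lee_fin ndF.
have cf : (\int[mu]_x (h n x)%:E @[n --> \oo] --> \int[mu]_x (f x)%:E)%E.
  exact: cvg_int.
have : (\int[mu]_x (h n x)%:E @[n --> \oo] --> \int[mu]_x (average L f x)%:E)%E.
  under eq_cvg do rewrite (DLR_average_nnsfun L).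
  apply: cvg_int => [n|n x|x n m nm|x].
  - by apply: measurable_average; exact: measurable_funP.
  - by rewrite average_ge0.
  - by apply: le_class_sum => y; rewrite ler_wpM2l ?hndecr// ltW// weight_gt0.
  - by apply: cvg_class_sum => y; exact: cvgMl_tmp.
exact: cvg_unique cf.
Qed.

End weight.

(** * Conformality *)

Section conformal.
Context (G : groupType) (A : finType) (X : subshift G A) (R : realType).
Context (phi : points X * points X -> R).
Implicit Types (L : {fset G}) (x y z : points X) (f : points X -> R).
Implicit Types (B C : set (points X)).

(** The image of D is Borel because it is the preimage of D under the inverse
of [psi]. *)
Lemma holonomy_image B C D psi : holonomy B C psi ->
  measurable D -> D `<=` B -> holonomy D (psi @` D) psi.
Proof.
move=> [[mB mC [psiBC psiinj psisurj] mpsi [chi mchi chiK]] psigibbs] mD DB.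
have eD : psi @` D = C `&` chi @^-1` D.
  apply/seteqP; split=> [_ [x Dx <-]|z [/psisurj[x Bx <-]]] /=.
    by rewrite /= chiK; [split=> //; apply: psiBC|]; exact: DB.
  by rewrite chiK// => Dx; exists x.
split; last by move=> x Dx; exact/psigibbs/DB.
have mpsiD : measurable (psi @` D) by rewrite eD; exact: mchi.
split=> //.
- split.
  + by move=> x Dx; exists x.
  + by move=> x y /set_mem Dx /set_mem Dy; apply: psiinj; exact/mem_set/DB.
  + by move=> _ [x Dx <-]; exists x.
- exact: measurable_funS mpsi.
- exists chi; last by move=> x Dx; exact/chiK/DB.
  by apply: measurable_funS mchi => //; rewrite eD; exact: subIsetl.
Qed.

(** Extend by the identity off B. The extension need not be injective; it makes
[(x, psi' x)] a Gibbs pair everywhere, so that [phi (x, psi' x)] is measurable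
on the whole space. *)
Lemma holonomy_extension B C psi : holonomy B C psi ->
  exists psi' : points X -> points X, [/\ measurable_fun setT psi',
    forall x, B x -> psi' x = psi x & forall x, gibbs_rel (x, psi' x)].
Proof.
move=> [[mB _ _ mpsi _] psigibbs].
exists (fun x => if x \in B then psi x else x).
have memB : (fun x => x \in B) @^-1` [set true] = B.
  by apply/seteqP; split=> x; [exact: set_mem|exact: mem_set].
split.
- apply: measurable_fun_if; rewrite ?setTI ?memB//.
  by apply: (@measurable_fun_bool _ _ _ _ true); rewrite setTI memB.
- by move=> x /mem_set ->.
- by move=> x; case: ifPn => [/set_mem/psigibbs//|_]; exists fset0.
Qed.

Hypothesis G_countable : countable [set: G].
Hypothesis phi_cocycle : cocycle phi.
Context (mu : probability (points X) R) (mu_DLR : DLR phi mu).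

(** As the weights are positive, a point lies in the saturation of B exactly
when the average of the indicator of B at that point is nonzero for some L; these
averages have integral mu B. *)
Lemma DLR_nonsingular : gibbs_nonsingular mu.
Proof.
move=> B mB muB.
have [L eL] := @gibbs_rel_exhaustion G A X G_countable.
have i0 y : 0 <= (\1_B y : R) by rewrite indicE.
pose N n := [set y | average phi (L n) \1_B y != 0].
have mav n : measurable_fun setT (average phi (L n) \1_B).
  by apply: measurable_average => //; exact: measurable_indic.
have mN n : measurable (N n).
  rewrite -[N n]setTI.
  have -> : N n = average phi (L n) \1_B @^-1` [set~ 0].
    by apply/seteqP; split=> y /= /eqP.
  by apply: mav => //; apply: measurableC; exact: measurable_set1.
have -> : gibbs_saturation B = \bigcup_n N n.
  apply/seteqP; split=> [y [x Bx]|y [n _ /eqP yN]].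
    rewrite /= eL => -[n _ xy]; exists n => //; rewrite /N /=.
    have wB0 z : 0 <= weight phi (L n) z * \1_B z.
      by rewrite mulr_ge0// ltW// weight_gt0.
    have /= := class_sum_ge wB0 (agree_offC xy).
    rewrite indicE mem_set// mulr1 => wle; rewrite gt_eqF//.
    by apply: lt_le_trans wle; exact: weight_gt0.
  have [[x [Bx xy]]|h] := pselect (exists x, B x /\ agree_off (L n) (x, y)).
    by exists x => //=; apply: agree_off_gibbs xy.
  exfalso; apply: yN; rewrite /average class_sumE fsbig1// => x yx.
  rewrite indicE memNset ?mulr0// => Bx; apply: h; exists x; split=> //.
  exact: agree_offC.
apply: measure_negligible; first exact: bigcup_measurable.
apply: negligible_bigcup => n.
have : (\int[mu]_x `|(average phi (L n) \1_B x)%:E| = 0)%E.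
  rewrite -[RHS]muB (DLR_average_indic phi_cocycle G_countable mu_DLR (L n) mB).
  apply: eq_integral => x _; rewrite gee0_abs// lee_fin; exact: average_ge0.
move/ae_eq_integral_abs => /(_ measurableT) ae0.
have {}/ae0 : measurable_fun setT (fun x => (average phi (L n) \1_B x)%:E).
  exact/measurable_EFinP.
move=> [Z [mZ Z0 sZ]]; exists Z; split=> // x /eqP xN.
by apply: sZ => /= /(_ I) [].
Qed.

(** Averaging the integrand and averaging the indicator of C give the same
function, by [weight_cocycle] and [class_sum_bij]. *)
Lemma DLR_conformal_agree L B C psi : holonomy B C psi ->
  (forall x, B x -> agree_off L (x, psi x)) ->
  mu C = (\int[mu]_(x in B) (expR (phi (x, psi x)))%:E)%E.
Proof.
move=> psiH psiL; have [[mB mC psibij _ _] _] := psiH.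
have [psi' [mpsi' psi'E psi'gibbs]] := holonomy_extension psiH.
pose f x := \1_B x * expR (phi (x, psi' x)).
have mf : measurable_fun setT f.
  apply: measurable_funM; first exact: measurable_indic.
  by apply: measurableT_comp;
    [exact: measurable_expR|exact: measurable_cocycle_graph].
have f0 x : 0 <= f x by rewrite mulr_ge0 ?expR_ge0// indicE.
transitivity (\int[mu]_x (f x)%:E)%E; last first.
  rewrite [RHS]integral_mkcond; apply: eq_integral => x _.
  rewrite patchE /f indicE; case: ifPn => [/set_mem xB|_]; last first.
    by rewrite mul0r.
  by rewrite mul1r psi'E.
rewrite (DLR_average phi_cocycle G_countable mu_DLR L mf f0).
rewrite (DLR_average_indic phi_cocycle G_countable mu_DLR L mC).
apply: eq_integral => x _; congr (_%:E).
transitivity (class_sum L (fun y => \1_C y * weight phi L y) x).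
  by apply: eq_class_sum => y _; rewrite mulrC.
rewrite -(class_sum_bij _ _ psibij psiL); apply: eq_class_sum => y _.
rewrite /f indicE; case: (boolP (y \in B)) => [/set_mem yB|_]; last first.
  by rewrite !mul0r mulr0.
by rewrite !mul1r psi'E// (weight_cocycle phi_cocycle)//; exact: psiL.
Qed.

(** Cut B into the disjoint pieces of points x for which L n is the first set
of the enumeration off which x and [psi x] agree; each piece and its image form
a holonomy of the bounded kind. *)
Lemma DLR_conformal : conformal phi mu.
Proof.
split; first exact: DLR_nonsingular.
move=> B C psi psiH.
have [[mB mC [psiBC psiinj psisurj] _ _] psigibbs] := psiH.
have [psi' [mpsi' psi'E psi'gibbs]] := holonomy_extension psiH.
have [L eL] := @gibbs_rel_exhaustion G A X G_countable.
pose E n := B `&` [set x | agree_off (L n) (x, psi x)].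
have mE n : measurable (E n).
  have -> : E n = B `&` [set x | agree_off (L n) (x, psi' x)].
    by apply/seteqP; split=> x [Bx]; rewrite /= psi'E.
  apply: measurableI => //; rewrite -[X in measurable X]setTI.
  have mgraph : measurable_fun setT (fun x => (x, psi' x)).
    by apply: measurable_fun_pair => //; exact: measurable_id.
  by apply: mgraph => //; exact: measurable_agree_off.
pose D := seqDU E.
have DE n : D n `<=` E n by exact: subset_seqDU.
have DB n : D n `<=` B by move=> x /DE[].
have mD n : measurable (D n) by apply: seqDU_measurable.
have eB : B = \bigcup_n D n.
  rewrite /D -seqDU_bigcup_eq; apply/seteqP; split=> [x Bx|x [n _ []]//].
  by have := psigibbs x Bx; rewrite eL => -[n _ ?]; exists n.
have eC : C = \bigcup_n psi @` D n.
  rewrite -image_bigcup -eB; apply/seteqP; split=> [z /psisurj//|_ [x Bx <-]].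
  exact: psiBC.
have HD n := holonomy_image psiH (mD n) (DB n).
rewrite [in RHS]eB ge0_integral_bigcup//=.
- rewrite [in LHS]eC measure_semi_bigcup//.
  + apply: eq_eseriesr => n _; apply: (DLR_conformal_agree (L := L n) (HD n)).
    by move=> x /DE[].
  + by move=> n; have [[]] := HD n.
  + move=> i j _ _ [_ [[x Dx <-] [y Dy yx]]].
    have xy : y = x.
      by apply: psiinj => //; apply/mem_set/DB; [exact: Dy|exact: Dx].
    by apply: (trivIset_seqDU E i j) => //; exists x; split=> //; rewrite -xy.
  + by rewrite -eC.
- rewrite -eB; apply/measurable_EFinP/(@measurableT_comp _ _ _ _ _ _ expR).
    exact: measurable_expR.
  apply: (eq_measurable_fun (fun x => phi (x, psi' x))).
    by move=> x /set_mem Bx; rewrite psi'E.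
  by apply: (measurable_funS measurableT) => //; exact: measurable_cocycle_graph.
- exact: trivIset_seqDU.
Qed.

End conformal.

Theorem theorem5 (G : groupType) (G_countable : countable [set: G])
    (A : finType) (X : subshift G A) (R : realType)
    (phi : points X * points X -> R) (phi_cocycle : cocycle phi)
    (mu : probability (points X) R) (mu_DLR : DLR phi mu) :
  conformal phi mu.
Proof. exact: DLR_conformal. Qed.
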